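(* Let $\mathbf{c}_0\in\mathbb{N}^n$ be a non-binary initial configuration on the directed cycle $C_n$. Then there is a binary configuration $\widehat{\mathbf{c}}_0$ on $C_n$ such that $\mathcal{A}(C_n,\mathbf{c}_0)=\mathcal{A}(C_n,\widehat{\mathbf{c}}_0)$ (equality of simplicial complexes on the vertices of $C_n$).
   Context: $\mathbb{N}$ includes $0$. $C_n$ is the directed cycle with vertices $v_1,\dots,v_n$ and edges $(v_i,v_{i+1})$, indices modulo $n$; every vertex has out-degree $1$ and there are no sinks. A configuration is a vector $\mathbf{c}\in\mathbb{N}^n$, where $\mathbf{c}(v_i)$ is the number of grains on $v_i$; it is binary if every entry is $0$ or $1$. Parallel-firing sandpile dynamics started from $\mathbf{c}_0$: at each time $t=0,1,2,\dots$ the firing set $\sigma_t$ is the set of vertices $v_i$ with $\mathbf{c}_t(v_i)\ge 1$; all of these fire simultaneously, each sending one grain to its out-neighbour, so that $\mathbf{c}_{t+1}(v_i)=\mathbf{c}_t(v_i)-[v_i\in\sigma_t]+[v_{i-1}\in\sigma_t]$ (where $[\cdot]$ is $1$ if the condition holds and $0$ otherwise). The avalanche complex $\mathcal{A}(C_n,\mathbf{c}_0)$ is the simplicial complex generated by the firing sets, i.e. the simplices are all nonempty subsets of the sets $\sigma_t$, $t\ge 0$ (vertices that never fire are not vertices of the complex). *)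

(* Defs.v *)
From mathcomp Require Import all_boot.
From mathcomp Require Import classical_sets.

Set Implicit Arguments.
Unset Strict Implicit.
Unset Printing Implicit Defensive.

(* The vertices v_1, ..., v_n of the directed cycle are the elements
   0, ..., n - 1 of 'I_n; the unique in-neighbour of i is [ord_pred i],
   i.e. i - 1 modulo n. *)
Definition config (n : nat) : Type := {ffun 'I_n -> nat}.

Definition binary (n : nat) (c : config n) : bool := [forall i, c i <= 1].

Definition firing_set (n : nat) (c : config n) : {set 'I_n} :=
  [set i : 'I_n | 1 <= c i].

(* The subtraction on nat never truncates: i \in firing_set c gives 1 <= c i. *)
Definition fire (n : nat) (c : config n) : config n :=
  [ffun i => c i - (i \in firing_set c) + (ord_pred i \in firing_set c)].

Definition config_at (n : nat) (c0 : config n) (t : nat) : config n :=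
  iter t (@fire n) c0.

(* A simplicial complex is given by its set of (nonempty) simplices. *)
Definition avalanche_complex (n : nat) (c0 : config n) : set {set 'I_n} :=
  [set A : {set 'I_n} | A != finset.set0 /\
    exists t : nat, A \subset firing_set (config_at c0 t)]%classic.

(* Main.v *)
Require Import Defs.
From mathcomp Require Import all_boot.
From mathcomp Require Import boolp classical_sets.

(** Seen from a frame that rotates by one step per unit of time, the set of
    firing vertices can only grow: a vertex whose in-neighbour fires holds a
    grain at the next step ([mem_firing_set_fire]).  Being subsets of a finite
    set, the rotated firing sets reach a largest one, [S].  It is attained at
    some multiple of [n], where the rotating frame agrees with the fixed one.

    The avalanche complex is therefore generated by the rotations of [S].
    Every firing set lies in a rotation of [S], by maximality; conversely, the
    rotation of [S] by [t] steps lies in the firing set reached [t] steps after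
    [S] was attained.

    Finally, a binary configuration is rigidly rotated by the dynamics
    ([fire_indicator]), because each occupied vertex gives away its only grain.
    Started from the indicator of [S], the firing sets are exactly the
    rotations of [S], so the two complexes coincide. *)

(** Growth of the number of elements bounds how often the sequence can
    increase strictly, hence some term contains all the others. *)
Lemma homo_subset_has_greatest (T : finType) (s : nat -> {set T}) :
    {homo s : k m / k <= m >-> k \subset m} ->
  exists N, forall m, s m \subset s N.
Proof.
move=> s_mono.
suff greatest_above d k : #|T| - #|s k| <= d ->
    exists N, forall m, s m \subset s N by exact: (greatest_above _ 0 (leqnn _)).
elim: d k => [|d IHd] k le_d.
  exists k => m; suff -> : s k = [set: T]%SET by exact: finset.subsetT.
  by apply/eqP; rewrite eqEcard finset.subsetT cardsT -subn_eq0 -leqn0.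
have [top_k|] := pselect (forall m, s m \subset s k); first by exists k.
move=> /existsNP[m /negP not_sub]; apply: (IHd (maxn k m)).
have lt_card : #|s k| < #|s (maxn k m)|.
  apply/proper_card/fintype.properP; split; first exact/s_mono/leq_maxl.
  have [x xm xk] := fintype.subsetPn not_sub; exists x => //.
  exact: fintype.subsetP (s_mono _ _ (leq_maxr k m)) _ xm.
rewrite -ltnS; apply: leq_trans le_d; apply: ltn_sub2l => //.
exact: leq_trans lt_card (max_card _).
Qed.

Lemma val_iter_ord_pred (n k : nat) (i : 'I_n) :
  val (iter k (@ord_pred n) i) = (i + k * n.-1) %% n.
Proof.
have n_gt0 : 0 < n by case: n i => [[]|].
elim: k => [|k IHk]; first by rewrite mul0n addn0 modn_small.
rewrite iterS /= IHk -subn1 -addnBA // subn1 modnDml.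
by rewrite -addnA mulSn [n.-1 + _]addnC.
Qed.

Lemma iter_ord_pred_mul (n k : nat) (i : 'I_n) : iter (k * n) (@ord_pred n) i = i.
Proof.
apply: val_inj; rewrite val_iter_ord_pred mulnAC addnC modnMDl.
exact: modn_small.
Qed.

Lemma mem_firing_set_fire (n : nat) (c : config n) (i : 'I_n) :
  ord_pred i \in firing_set c -> i \in firing_set (fire c).
Proof. by move=> fires; rewrite inE ffunE fires addn1. Qed.

(** The growth of the firing sets in the rotating frame, over several steps. *)
Lemma mem_firing_set_config_at (n : nat) (c : config n) (t k : nat) (i : 'I_n) :
    iter k (@ord_pred n) i \in firing_set (config_at c t) ->
  i \in firing_set (config_at c (k + t)).
Proof.
elim: k i => [//|k IHk] i; rewrite iterSr => /IHk.
exact: mem_firing_set_fire.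
Qed.

Lemma firing_set_mul_homo (n : nat) (c : config n) :
  {homo (fun k => firing_set (config_at c (k * n))) :
     k m / k <= m >-> k \subset m}.
Proof.
move=> k m le_km; apply/fintype.subsetP => i fires.
rewrite -(subnK le_km) mulnDl; apply: mem_firing_set_config_at.
by rewrite iter_ord_pred_mul.
Qed.

Definition indicator (n : nat) (S : {set 'I_n}) : config n :=
  [ffun i => nat_of_bool (i \in S)].

Lemma binary_indicator (n : nat) (S : {set 'I_n}) : binary (indicator n S).
Proof. by apply/forallP => i; rewrite ffunE leq_b1. Qed.

Lemma firing_set_indicator (n : nat) (S : {set 'I_n}) :
  firing_set (indicator n S) = S.
Proof. by apply/setP => i; rewrite inE ffunE lt0b. Qed.

Lemma fire_indicator (n : nat) (S : {set 'I_n}) :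
  fire (indicator n S) = indicator n (@ord_pred n @^-1: S)%SET.
Proof.
by apply/ffunP => i; rewrite ffunE firing_set_indicator !ffunE subnn inE.
Qed.

Lemma mem_firing_set_indicator_at (n : nat) (S : {set 'I_n}) (t : nat) (i : 'I_n) :
  (i \in firing_set (config_at (indicator n S) t)) =
  (iter t (@ord_pred n) i \in S).
Proof.
elim: t S => [|t IHt] S; first by rewrite firing_set_indicator.
by rewrite /config_at iterSr fire_indicator [LHS]IHt inE.
Qed.

Theorem theorem3p15 (n : nat) (c0 : config n) (hc0 : ~~ binary c0) :
  exists chat0 : config n,
    binary chat0 /\ avalanche_complex c0 = avalanche_complex chat0.
Proof.
have [N greatest] := homo_subset_has_greatest _ _ (firing_set_mul_homo n c0).
exists (indicator n (firing_set (config_at c0 (N * n)))).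
split; first exact: binary_indicator.
apply/seteqP; split=> A [A_neq0 [t /fintype.subsetP sub_t]]; split=> //.
  exists t; apply/fintype.subsetP => i /sub_t fires; rewrite mem_firing_set_indicator_at.
  apply: (fintype.subsetP (greatest t)).
  have n_gt0 : 0 < n by case: (n) i {fires} => [[]|].
  (* The firing at [i] moves on with the rotating frame; at time [t * n] that
     frame is back in place, and the firing is at the vertex [t] steps before [i]. *)
  have le_tn : t <= t * n by rewrite leq_pmulr.
  rewrite -(subnK le_tn); apply: mem_firing_set_config_at.
  by rewrite -iterD subnK // iter_ord_pred_mul.
exists (t + N * n); apply/fintype.subsetP => i /sub_t.
rewrite mem_firing_set_indicator_at; exact: mem_firing_set_config_at.
Qed.
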